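(* Let $A\in\mathbb{H}^{m\times n}$. Then: (a) $\dim(\mathcal{R}_l(A))+\dim(\mathcal{N}_l(A))=m$. (b) $\dim(\mathcal{R}_r(A))+\dim(\mathcal{N}_r(A))=n$.
   Context: $\mathbb{H}$ denotes the real quaternions. For $A\in\mathbb{H}^{m\times n}$: $\mathcal{R}_l(A)=\{xA : x\in\mathbb{H}^{1\times m}\}$ and $\mathcal{N}_l(A)=\{x\in\mathbb{H}^{1\times m} : xA=0\}$, whose dimensions are taken as left quaternion vector spaces; $\mathcal{R}_r(A)=\{Ax : x\in\mathbb{H}^{n\times 1}\}$ and $\mathcal{N}_r(A)=\{x\in\mathbb{H}^{n\times 1} : Ax=0\}$, whose dimensions are taken as right quaternion vector spaces. *)

(* Defs.v *)
From HB Require Import structures.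
From mathcomp Require Import all_boot all_order all_algebra.
From mathcomp Require Import all_classical all_reals.
From mathcomp Require Import ring lra.

Set Implicit Arguments.
Unset Strict Implicit.
Unset Printing Implicit Defensive.
Import Order.TTheory GRing.Theory Num.Theory.
Local Open Scope classical_set_scope.
Local Open Scope ring_scope.

(* [Quat a b c d] is a + b i + c j + d k. *)
Record quat (R : Type) := Quat { qre : R; qi : R; qj : R; qk : R }.

Section QuatRing.
Variable R : realType.
Local Notation H := (quat R).
Implicit Types p q : H.

Definition tuple_of_quat q := (qre q, qi q, qj q, qk q).
Definition quat_of_tuple (t : R * R * R * R) : H :=
  let: (a, b, c, d) := t in Quat a b c d.
Lemma tuple_of_quatK : cancel tuple_of_quat quat_of_tuple.
Proof. by case. Qed.

HB.instance Definition _ := Choice.copy H (can_type tuple_of_quatK).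

Definition addq p q :=
  Quat (qre p + qre q) (qi p + qi q) (qj p + qj q) (qk p + qk q).
Definition oppq q : H := Quat (- qre q) (- qi q) (- qj q) (- qk q).
Definition zeroq : H := Quat 0 0 0 0.
Definition oneq : H := Quat 1 0 0 0.
Definition mulq p q : H :=
  Quat
    (qre p * qre q - qi p * qi q - qj p * qj q - qk p * qk q)
    (qre p * qi q + qi p * qre q + qj p * qk q - qk p * qj q)
    (qre p * qj q - qi p * qk q + qj p * qre q + qk p * qi q)
    (qre p * qk q + qi p * qj q - qj p * qi q + qk p * qre q).

Lemma addqA : associative addq.
Proof. by move=> [????] [????] [????]; congr Quat => /=; ring. Qed.
Lemma addqC : commutative addq.
Proof. by move=> [????] [????]; congr Quat => /=; ring. Qed.
Lemma add0q : left_id zeroq addq.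
Proof. by move=> [????]; congr Quat => /=; ring. Qed.
Lemma addNq : left_inverse zeroq oppq addq.
Proof. by move=> [????]; congr Quat => /=; ring. Qed.

HB.instance Definition _ := GRing.isZmodule.Build H addqA addqC add0q addNq.

Lemma mulqA : associative mulq.
Proof. by move=> [????] [????] [????]; congr Quat => /=; ring. Qed.
Lemma mul1q : left_id oneq mulq.
Proof. by move=> [????]; congr Quat => /=; ring. Qed.
Lemma mulq1 : right_id oneq mulq.
Proof. by move=> [????]; congr Quat => /=; ring. Qed.
Lemma mulqDl : left_distributive mulq addq.
Proof. by move=> [????] [????] [????]; congr Quat => /=; ring. Qed.
Lemma mulqDr : right_distributive mulq addq.
Proof. by move=> [????] [????] [????]; congr Quat => /=; ring. Qed.
Lemma oneq_neq0 : oneq != 0.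
Proof. by apply/eqP => -[/eqP]; rewrite oner_eq0. Qed.

HB.instance Definition _ :=
  GRing.Zmodule_isNzRing.Build H mulqA mul1q mulq1 mulqDl mulqDr oneq_neq0.

Definition normsqq q : R := qre q ^+ 2 + qi q ^+ 2 + qj q ^+ 2 + qk q ^+ 2.
Definition invq q : H :=
  Quat (qre q / normsqq q) (- qi q / normsqq q)
       (- qj q / normsqq q) (- qk q / normsqq q).
Definition unitq : pred H := [pred q | q != 0].

Lemma normsqq_eq0 q : (normsqq q == 0) = (q == 0).
Proof.
apply/eqP/eqP => [|->]; last by rewrite /normsqq /= expr0n /= !addr0.
case: q => a b c d; rewrite /normsqq /= => h.
have := (sqr_ge0 a, sqr_ge0 b, sqr_ge0 c, sqr_ge0 d) => -[[[ha hb] hc] hd].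
have z x : x ^+ 2 = 0 -> x = 0 :> R by move/eqP; rewrite sqrf_eq0 => /eqP.
by congr Quat; apply: z; lra.
Qed.

Lemma mulVq : {in unitq, left_inverse 1 invq *%R}.
Proof.
move=> q; rewrite inE -normsqq_eq0.
case: q => a b c d; rewrite /normsqq /= => n0.
by congr Quat; rewrite /= /normsqq /=; field.
Qed.
Lemma mulqV : {in unitq, right_inverse 1 invq *%R}.
Proof.
move=> q; rewrite inE -normsqq_eq0.
case: q => a b c d; rewrite /normsqq /= => n0.
by congr Quat; rewrite /= /normsqq /=; field.
Qed.
Lemma unitqP p q : q * p = 1 /\ p * q = 1 -> unitq p.
Proof.
move=> [qp _]; apply/eqP => p0.
by move/eqP: qp; rewrite p0 mulr0 eq_sym oner_eq0.
Qed.
Lemma invq_out : {in [predC unitq], invq =1 id}.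
Proof.
by move=> q; rewrite !inE negbK => /eqP->; congr Quat; rewrite /= ?oppr0 mul0r.
Qed.

HB.instance Definition _ :=
  GRing.NzRing_hasMulInverse.Build H mulVq mulqV unitqP invq_out.

Lemma quat_unitE q : (q \is a GRing.unit) = (q != 0).
Proof. by []. Qed.

End QuatRing.

Section Dimension.
Variables (K : nzRingType) (V : lmodType K).

Definition lin_indep d (b : 'I_d -> V) : Prop :=
  forall c : 'I_d -> K, \sum_i c i *: b i = 0 -> forall i, c i = 0.

Definition lspan d (b : 'I_d -> V) : set V :=
  [set v | exists c : 'I_d -> K, v = \sum_i c i *: b i].

Definition is_basis (S : set V) d (b : 'I_d -> V) : Prop :=
  lin_indep b /\ lspan b = S.

(* The value 0 for a set S without a finite basis is a default; by
   [subspace_has_basis] it is never used for subspaces of K^(m x n), K a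
   division ring, and by [vdim_basis] the choice of the basis is irrelevant. *)
Definition vdim (S : set V) : nat :=
  xget 0%N [set d | exists b : 'I_d -> V, is_basis S b].

Definition is_subspace (S : set V) : Prop :=
  [/\ S 0, (forall u v, S u -> S v -> S (u + v)) &
      (forall a v, S v -> S (a *: v))].

End Dimension.

Section DivisionRing.
Variable K : unitRingType.
Hypothesis unitK : forall x : K, x != 0 -> x \is a GRing.unit.

Lemma row_dependent d e (M : 'I_e -> 'I_d -> K) : (d < e)%N ->
  exists2 c : 'I_e -> K, exists i, c i != 0 &
    forall j, \sum_i c i * M i j = 0.
Proof.
elim: d e M => [|d IH] [|e] M //.
  by move=> _; exists (fun=> 1); [exists ord0; rewrite oner_eq0|case].
rewrite ltnS => de.
have [[p Mp]|M0] := pselect (exists p, M p ord0 != 0); last first.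
  have {}M0 i : M i ord0 = 0 by apply/eqP/negPn/negP => Mi; apply: M0; exists i.
  have [c c0 cM] := IH _ (fun i j => M i (lift ord0 j)) (leqW de).
  exists c => // j; case: (unliftP ord0 j) => [k ->|->]; first exact: cM.
  by apply: big1 => i _; rewrite M0 mulr0.
have [c [i0 ci0] cM] := IH _ (fun i j =>
  M (lift p i) (lift ord0 j) -
  M (lift p i) ord0 * (M p ord0)^-1 * M p (lift ord0 j)) de.
pose cp := - \sum_i c i * M (lift p i) ord0 * (M p ord0)^-1.
pose c' i := if unlift p i is Some k then c k else cp.
exists c'; first by exists (lift p i0); rewrite /c' liftK.
move=> j; rewrite (bigD1_ord p) //= {1}/c' unlift_none.
under eq_bigr do rewrite /c' liftK.
rewrite /cp mulNr; case: (unliftP ord0 j) => [k ->|->].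
  rewrite mulr_suml addrC -sumrB -[RHS](cM k); apply: eq_bigr => i _.
  by rewrite mulrBr !mulrA.
rewrite mulr_suml addrC -sumrB; apply: big1 => i _.
by rewrite -!mulrA mulVr ?mulr1 ?subrr // unitK.
Qed.

Lemma lin_indep_leq (V : lmodType K) d e (b : 'I_d -> V) (b' : 'I_e -> V) :
  (forall i, lspan b (b' i)) -> lin_indep b' -> (e <= d)%N.
Proof.
move=> /choice[M b'E] ind; rewrite leqNgt; apply/negP => de.
have [c [i /eqP ci] cM] := row_dependent M de.
apply/ci/ind; under eq_bigr do rewrite b'E scaler_sumr.
rewrite exchange_big /=; apply: big1 => j _.
under eq_bigr do rewrite scalerA.
by rewrite -scaler_suml cM scale0r.
Qed.

Lemma lspan_gen (V : lmodType K) d (b : 'I_d -> V) i : lspan b (b i).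
Proof.
exists (fun j => (j == i)%:R); rewrite (bigD1 i) //= eqxx scale1r.
by rewrite big1 ?addr0 // => j /negPf->; rewrite scale0r.
Qed.

Lemma vdim_basis (V : lmodType K) (S : set V) d (b : 'I_d -> V) :
  is_basis S b -> vdim S = d.
Proof.
move=> bS; apply: xget_unique => [|e [b' [b'i b'S]]]; first by exists b.
case: bS => bi bS; apply/eqP; rewrite eqn_leq; apply/andP; split.
  apply: (@lin_indep_leq V _ _ b b') => // i.
  by rewrite bS -b'S; apply: lspan_gen.
apply: (@lin_indep_leq V _ _ b' b) => // i.
by rewrite b'S -bS; apply: lspan_gen.
Qed.

Lemma subspace_has_basis m n (S : set 'M[K]_(m, n)) : is_subspace S ->
  exists d (b : 'I_d -> 'M[K]_(m, n)), is_basis S b.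
Proof.
move=> [S0 SD SZ].
pose P d := `[< exists2 b : 'I_d -> 'M[K]_(m, n),
  lin_indep b & forall i, S (b i) >].
have P0 : exists d, P d.
  by exists 0%N; apply/asboolP; exists (fun=> 0) => [c _ []|[]].
have Pub d : P d -> (d <= #|{: 'I_m * 'I_n}|)%N.
  move=> /asboolP[b bi _].
  pose E (k : 'I_#|{: 'I_m * 'I_n}|) : 'M[K]_(m, n) :=
    delta_mx (enum_val k).1 (enum_val k).2.
  apply: (lin_indep_leq (b := E)) bi => i.
  exists (fun k => b i (enum_val k).1 (enum_val k).2).
  rewrite {1}[b i]matrix_sum_delta pair_bigA /=.
  by rewrite (eq_bigl (mem {: 'I_m * 'I_n})) // big_enum_val.
case: (ex_maxnP P0 Pub) => d /asboolP[b bi bS] dmax.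
exists d, b; split=> //; apply/seteqP; split=> [v [c ->]|v Sv].
  by elim/big_ind: _ => // i _; apply: SZ.
apply: contrapT => nv.
suff /dmax : P d.+1 by rewrite ltnn.
apply/asboolP; pose b' i := if unlift ord0 i is Some k then b k else v.
exists b' => [c|i]; last by rewrite /b'; case: unliftP.
rewrite big_ord_recl /b' unlift_none.
under eq_bigr do rewrite liftK.
have [c0|c0] := eqVneq (c ord0) 0.
  rewrite c0 scale0r add0r => /bi ci i.
  by case: (unliftP ord0 i) => [k ->|->].
move=> e; case: nv; exists (fun k => - (c ord0)^-1 * c (lift ord0 k)).
under eq_bigr do rewrite -scalerA.
rewrite -scaler_sumr; move/eqP: e; rewrite addr_eq0 => /eqP e.
by rewrite scaleNr -scalerN -e scalerA mulVr ?unitK // scale1r.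
Qed.

End DivisionRing.

Section RowColSpaces.
Variable R : realType.
Local Notation H := (quat R).

Definition row_range m n (A : 'M[H]_(m, n)) : set 'rV[H]_n :=
  [set x *m A | x in [set: 'rV[H]_m]].
Definition row_null m n (A : 'M[H]_(m, n)) : set 'rV[H]_m :=
  [set x | x *m A = 0].
Definition col_range m n (A : 'M[H]_(m, n)) : set 'cV[H]_m :=
  [set A *m x | x in [set: 'cV[H]_n]].
Definition col_null m n (A : 'M[H]_(m, n)) : set 'cV[H]_n :=
  [set x | A *m x = 0].

Definition ldim n (S : set 'rV[H]_n) : nat := vdim S.

(* A right H-vector space is a left vector space over the opposite ring H^c,
   whose scaling [a *: x] is x multiplied by a on the right, cf. [rscaleE]. *)
Definition rdim n (S : set 'cV[H]_n) : nat :=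
  vdim (S : set 'cV[H^c]_n).

Lemma rscaleE n (a : H) (x : 'cV[H]_n) i j :
  ((a : H^c) *: (x : 'cV[H^c]_n)) i j = x i j * a.
Proof. by rewrite mxE. Qed.

End RowColSpaces.

(* Main.v *)
Require Import Defs.
From HB Require Import structures.
From mathcomp Require Import all_boot all_order all_algebra.
From mathcomp Require Import all_classical all_reals.

Set Implicit Arguments.
Unset Strict Implicit.
Unset Printing Implicit Defensive.
Import GRing.Theory.
Local Open Scope classical_set_scope.
Local Open Scope ring_scope.

(** Over a division ring, a basis of the kernel of a linear map together with
    preimages of a basis of its range is a basis of the source. Right
    quaternion spaces are left spaces over the opposite division ring. *)

Lemma is_basis_ker_range (K : unitRingType) (V W : lmodType K)
    (f : {linear V -> W}) d e (b : 'I_d -> W) (c : 'I_e -> V) :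
  is_basis (range f) b -> is_basis [set x | f x = 0] c ->
  exists w : 'I_(d + e) -> V, is_basis setT w.
Proof.
move=> [bi bS] [ci cS].
have /choice[v vE] i : exists x, f x = b i.
  have : range f (b i) by rewrite -bS; apply: lspan_gen.
  by case=> x _ <-; exists x.
have fc i : f (c i) = 0.
  by have : [set x | f x = 0] (c i) by rewrite -cS; apply: lspan_gen.
pose w i := match fintype.split i with inl j => v j | inr j => c j end.
have wl j : w (lshift e j) = v j by rewrite /w (unsplitK (inl _ j)).
have wr j : w (rshift d j) = c j by rewrite /w (unsplitK (inr _ j)).
have wsum (a : 'I_(d + e) -> K) : \sum_i a i *: w i =
    \sum_i a (lshift e i) *: v i + \sum_i a (rshift d i) *: c i.
  rewrite big_split_ord /=.
  by congr (_ + _); apply: eq_bigr => i _; rewrite ?wl ?wr.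
have fv (a : 'I_d -> K) : f (\sum_i a i *: v i) = \sum_i a i *: b i.
  by rewrite linear_sum; apply: eq_bigr => i _; rewrite linearZ /= vE.
have f0 (a : 'I_e -> K) : f (\sum_i a i *: c i) = 0.
  by rewrite linear_sum big1 // => i _; rewrite linearZ /= fc scaler0.
exists w; split=> [a|].
  rewrite wsum => a0.
  (* Applying [f] to the relation kills the [c] part and leaves a relation among the [b i]; the
     remaining relation then involves only the [c i]. *)
  have al : forall i, a (lshift e i) = 0.
    by apply: bi; rewrite -fv -[LHS]addr0 -{1}(f0 (a \o @rshift d e)) -raddfD a0 raddf0.
  have ar : forall i, a (rshift d i) = 0.
    apply: ci; rewrite -[RHS]a0 [X in _ = X + _]big1 ?add0r// => i _.
    by rewrite al scale0r.
  by move=> i; rewrite -(splitK i); case: (fintype.split i) => j /=; rewrite ?al ?ar.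
apply/seteqP; split=> // x _.
(* The coordinates of [f x] in [b], used as coefficients of the preimages [v], correct [x] to an
   element of the kernel. *)
have : lspan b (f x) by rewrite bS; exists x.
move=> [a aE].
have : lspan c (x - \sum_i a i *: v i).
  by rewrite cS /= raddfB /= fv aE subrr.
move=> [a' a'E].
exists (fun i => match fintype.split i with inl j => a j | inr j => a' j end).
rewrite wsum -[LHS](subrK (\sum_i a i *: v i)) a'E addrC.
congr (_ + _); apply: eq_bigr => i _.
  by rewrite (unsplitK (inl _ i)).
by rewrite (unsplitK (inr _ i)).
Qed.

(** The matrix units form such a basis; this fixes the dimension of the source in [rank_nullity]. *)
Lemma is_basis_delta_mx (K : nzRingType) m n :
  exists b : 'I_(m * n) -> 'M[K]_(m, n), is_basis setT b.
Proof.
(* Written as a cardinal, the size lets [enum_val] turn a single index into a pair (row, column). *)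
have -> : (m * n = #|{: 'I_m * 'I_n}|)%N by rewrite card_prod !card_ord.
pose E (k : 'I_#|{: 'I_m * 'I_n}|) : 'M[K]_(m, n) :=
  delta_mx (enum_val k).1 (enum_val k).2.
have EE (A : 'M[K]_(m, n)) :
    A = \sum_k A (enum_val k).1 (enum_val k).2 *: E k.
  rewrite {1}[A]matrix_sum_delta pair_bigA /=.
  by rewrite (eq_bigl (mem {: 'I_m * 'I_n})) // big_enum_val.
exists E; split=> [c c0 k|].
  have /matrixP/(_ (enum_val k).1 (enum_val k).2) := c0.
  rewrite summxE (bigD1 k) //= !mxE !eqxx mulr1 big1 ?addr0// => l lk.
  rewrite !mxE -xpair_eqE -!surjective_pairing.
  by rewrite (inj_eq enum_val_inj) eq_sym (negPf lk) mulr0.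
apply/seteqP; split=> // A _.
by exists (fun k => A (enum_val k).1 (enum_val k).2).
Qed.

(** The source has a basis of size [d + e] glued from kernel and range, and one of size [m * n] made
    of matrix units; [vdim_basis] equates the two sizes. *)
Lemma rank_nullity (K : unitRingType)
    (unitK : forall x : K, x != 0 -> x \is a GRing.unit) m n p q
    (f : {linear 'M[K]_(m, n) -> 'M[K]_(p, q)}) :
  (vdim (range f) + vdim [set x | f x = 0%R] = m * n)%N.
Proof.
(* Being subspaces of matrix spaces, range and kernel have finite bases, so [vdim] does not take its
   default value on them. *)
have sr : is_subspace (range f).
  split=> [|_ _ [x _ <-] [y _ <-]|a _ [x _ <-]].
  - by exists 0 => //; exact: linear0.
  - by exists (x + y) => //; exact: linearD.
  - by exists (a *: x) => //; exact: linearZ.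
have sk : is_subspace [set x | f x = 0].
  split=> /= [|x y fx fy|a x fx]; first exact: linear0.
  - by rewrite linearD fx fy addr0.
  - by rewrite linearZ /= fx scaler0.
have [d [b bS]] := subspace_has_basis unitK sr.
have [e [c cS]] := subspace_has_basis unitK sk.
have [w wS] := is_basis_ker_range bS cS.
have [w' w'S] := @is_basis_delta_mx K m n.
rewrite (vdim_basis unitK bS) (vdim_basis unitK cS).
by rewrite -(vdim_basis unitK wS) (vdim_basis unitK w'S).
Qed.

Theorem lemma3p14 (R : realType) (m n : nat) (A : 'M[quat R]_(m, n)) :
  (ldim (row_range A) + ldim (row_null A) = m)%N /\
  (rdim (col_range A) + rdim (col_null A) = n)%N.
Proof.
split.
  rewrite -[RHS]mul1n.
  by apply: (@rank_nullity (quat R) _ 1 m 1 n (mulmxr A)).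
(* The product is computed in [quat R]; only the scalars act through the opposite ring. They
   multiply on the right, so associativity makes left multiplication by [A] linear. *)
pose f (x : 'cV[(quat R)^c]_n) : 'cV[(quat R)^c]_m := A *m (x : 'cV[quat R]_n).
have flin : linear f.
  move=> a x y; apply/matrixP => i j.
  rewrite mxE [RHS]mxE rscaleE !mxE mulr_suml -big_split /=.
  by apply: eq_bigr => k _; rewrite mxE rscaleE mulrDr mulrA.
pose fM := GRing.isLinear.Build _ _ _ _ f flin.
pose g : {linear 'cV[(quat R)^c]_n -> 'cV[(quat R)^c]_m} := HB.pack f fM.
by rewrite -[RHS]muln1; apply: (@rank_nullity (quat R)^c _ n 1 m 1 g).
Qed.
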